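(* Let $G$ be a fractal group. The following families of open normal subgroups of $G$ are self-similarity closed (that is, if $H$ belongs to the family, so does the self-similar closure of $H$ in $G$): (1) open, normal, and torsion subgroups; (2) open, normal, and pro-$p$ subgroups; (3) open, normal, and prosolvable subgroups.
   Context: In (2), $p$ is a fixed prime. Let $T$ be the infinite $d$-regular rooted tree, with path data: a labeling of the vertices at level one by $0,\dots,d-1$ and, for each such vertex $i$, a rooted tree isomorphism $\lambda_i:T_i\to T$, where $T_v$ denotes the subtree over a vertex $v$. For each vertex $v$ there is a unique composition $\lambda_v:T_v\to T$ of the $\lambda_i$'s taking $v$ to the root. For a subgroup $H\le\mathrm{Aut}\,T$, $H_v$ is the stabilizer of $v$ in $H$, $\pi_v(h)=\lambda_v\circ h|_{T_v}\circ\lambda_v^{-1}$ for $h\in H_v$, and $H^v=\pi_v(H_v)$. A closed subgroup $G\le\mathrm{Aut}\,T$ is self-similar if $G^v\subseteq G$ for every vertex $v$, and fractal if $G^v=G$ for every vertex $v$. The self-similar closure of a closed subgroup $H\le G$ is the smallest closed self-similar subgroup of $G$ containing $H$. *)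

(* Defs.v *)
From HB Require Import structures.
From mathcomp Require Import all_boot all_fingroup all_solvable.
From mathcomp Require Import boolp classical_sets functions.
From mathcomp Require Import topology.

Set Implicit Arguments.
Unset Strict Implicit.
Unset Printing Implicit Defensive.

Local Open Scope classical_set_scope.

(* The infinite d-regular rooted tree T is modelled on the set of finite words
   over 'I_d: the root is the empty word and the children of v are the words
   rcons v i. The path data on T are nevertheless arbitrary (see [path_data]);
   they need not be the evident ones deleting the first letter of a word. *)

Definition vertex (d : nat) : Type := seq 'I_d.

Definition root d : vertex d := [::].

Definition child d (v w : vertex d) : Prop := exists i : 'I_d, w = rcons v i.

Definition subtree d (v : vertex d) : set (vertex d) :=
  [set w | prefix v w].

(* The values of f outside of [subtree u] are irrelevant. *)
Definition tree_iso d (u v : vertex d) (f : vertex d -> vertex d) : Prop :=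
  [/\ f u = v,
      set_bij (subtree u) (subtree v) f &
      forall x y, subtree u x -> subtree u y ->
        (child (f x) (f y) <-> child x y)].

Record autT (d : nat) : Type := AutT {
  aut_fun :> vertex d -> vertex d;
  aut_isoP : tree_iso (root d) (root d) aut_fun }.

HB.instance Definition _ d := gen_eqMixin (autT d).
HB.instance Definition _ d := gen_choiceMixin (autT d).

(* The profinite topology of Aut T is that of pointwise convergence, the set of
   vertices being discrete. *)
HB.instance Definition _ d := Topological.copy (autT d)
  (initial_topology (@aut_fun d : autT d ->
     {ptws discrete_topology (vertex d) -> discrete_topology (vertex d)})).

Section GroupOfAutomorphisms.
Variable d : nat.
Implicit Types (g h : autT d) (u v w x y : vertex d).

Lemma autP g h : aut_fun g = aut_fun h -> g = h.
Proof.
case: g h => [f fP] [f' f'P] /= e; subst f'.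
by rewrite (Prop_irrelevance fP f'P).
Qed.

Lemma subtree_root x : subtree (root d) x.
Proof. exact: prefix0s. Qed.

Lemma subtree_refl v : subtree v v.
Proof. exact: prefix_refl. Qed.

Lemma tree_iso_id v : tree_iso v v id.
Proof. by split=> //; split=> // x vx; exists x. Qed.

Lemma tree_iso_comp u v w (f f' : vertex d -> vertex d) :
  tree_iso u v f -> tree_iso v w f' -> tree_iso u w (f' \o f).
Proof.
move=> [fu bf cf] [fv bf' cf']; split; first by rewrite /= fu.
  exact: set_bij_comp bf bf'.
have [funf _ _] := bf.
move=> x y ux uy; split => [/= /cf' H|/(cf _ _ ux uy) H].
  by apply/cf => //; apply: H; apply: funf.
by apply/cf' => //; apply: funf.
Qed.

Lemma tree_iso_pinv u v (f : vertex d -> vertex d) :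
  tree_iso u v f -> tree_iso v u ('pinv_(id) (subtree u) f).
Proof.
move=> [fu bf cf]; have [funf injf surf] := bf.
have bg := bijpinv_bij id bf.
have [fung _ _] := bg.
have fgK x : subtree v x -> f ('pinv_(id) (subtree u) f x) = x.
  by move=> vx; apply: (surjpK id surf); rewrite inE.
split => //.
  have vv := subtree_refl v; have uu := subtree_refl u.
  apply: injf; rewrite ?inE //; first exact: fung.
  by rewrite fgK.
move=> x y vx vy.
by rewrite -(cf _ _ (fung _ vx) (fung _ vy)) !fgK.
Qed.

Definition aut_one : autT d := AutT (tree_iso_id (root d)).
Definition aut_mul g h : autT d :=
  AutT (tree_iso_comp (aut_isoP h) (aut_isoP g)).
Definition aut_inv g : autT d := AutT (tree_iso_pinv (aut_isoP g)).

Lemma aut_mulA : associative aut_mul.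
Proof. by move=> f g h; exact: autP. Qed.

Lemma aut_mul1g : left_id aut_one aut_mul.
Proof. by move=> g; exact: autP. Qed.

Lemma aut_mulg1 : right_id aut_one aut_mul.
Proof. by move=> g; exact: autP. Qed.

Lemma aut_mulVg : left_inverse aut_one aut_inv aut_mul.
Proof.
move=> g; apply: autP; apply/funext => x /=.
have [_ [_ injg _] _] := aut_isoP g.
by apply: pinvKV => //; rewrite inE; exact: subtree_root.
Qed.

Lemma aut_mulgV : right_inverse aut_one aut_inv aut_mul.
Proof.
move=> g; apply: autP; apply/funext => x /=.
have [_ [_ _ surg] _] := aut_isoP g.
by apply: (surjpK id surg); rewrite inE; exact: subtree_root.
Qed.

HB.instance Definition _ := isGroup.Build (autT d)
  aut_mulA aut_mul1g aut_mulg1 aut_mulVg aut_mulgV.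

End GroupOfAutomorphisms.

Record path_data (d : nat) : Type := PathData {
  label : 'I_d -> vertex d;
  label_bij : set_bij [set: 'I_d] [set v | size v = 1] label;
  lam : 'I_d -> vertex d -> vertex d;
  lam_iso : forall i, tree_iso (label i) (root d) (lam i) }.

(* lambda_v is the identity if v is the root, and otherwise it is
   lambda_(lambda_i v) \o lambda_i for the unique level-one vertex (labelled) i
   above v; the recursion is on the level of v. *)
Fixpoint lambda_rec d (D : path_data d) (n : nat) (v : vertex d)
    : vertex d -> vertex d :=
  if n is n'.+1 then
    if [pick i | prefix (label D i) v] is Some i
    then lambda_rec D n' (lam D i v) \o lam D i
    else id
  else id.

Definition lambda d (D : path_data d) (v : vertex d) : vertex d -> vertex d :=
  lambda_rec D (size v) v.

Definition section d (D : path_data d) (v : vertex d) (h : autT d)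
    : vertex d -> vertex d :=
  lambda D v \o h \o 'pinv_(id) (subtree v) (lambda D v).

Definition stabilizer d (H : set (autT d)) (v : vertex d) : set (autT d) :=
  [set h | H h /\ h v = v].

(* H^v. No section is lost by requiring g to be an automorphism: see
   [section_iso] below. *)
Definition section_group d (D : path_data d) (H : set (autT d)) (v : vertex d)
    : set (autT d) :=
  [set g | exists2 h, stabilizer H v h & aut_fun g = section D v h].

Section PathDataFacts.
Variables (d : nat) (D : path_data d).
Implicit Types (v x y : vertex d) (i : 'I_d).

Lemma size_label i : size (label D i) = 1.
Proof. by have [f _ _] := label_bij D; exact: (f i). Qed.

Lemma label_inj : injective (label D).
Proof.
by have [_ f _] := label_bij D; move=> i j; apply: f; rewrite inE.
Qed.

Lemma label_prefix_inj i j v :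
  prefix (label D i) v -> prefix (label D j) v -> i = j.
Proof.
by rewrite !prefixE !size_label => /eqP ei /eqP ej; apply: label_inj; rewrite -ei -ej.
Qed.

Lemma label_prefix_ex v : v != root d -> exists i, prefix (label D i) v.
Proof.
case: v => // a v _; have [_ _ s] := label_bij D.
have [|i _ e] := s [:: a]; first by [].
by exists i; rewrite e prefix_cons eqxx prefix0s.
Qed.

Lemma tree_iso_size u v (f : vertex d -> vertex d) w :
  tree_iso u v f -> size (f (u ++ w)) = size v + size w.
Proof.
move=> [fu bf cf]; elim/last_ind: w => [|w a IH].
  by rewrite cats0 fu addn0.
have [b e] : child (f (u ++ w)) (f (u ++ rcons w a)).
  apply/cf; rewrite /subtree /= ?prefix_prefix //.
  by exists a; rewrite rcons_cat.
by rewrite e !size_rcons IH addnS.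
Qed.

Lemma lambda_root : lambda D (root d) = id.
Proof. by []. Qed.

Lemma lambdaE i v : subtree (label D i) v ->
  lambda D v = lambda D (lam D i v) \o lam D i.
Proof.
move=> iv; have [w e] := prefixP iv.
rewrite [in LHS]/lambda.
have -> : size v = (size (lam D i v)).+1.
  by rewrite e (tree_iso_size w (lam_iso D i)) size_cat size_label.
rewrite /=; case: pickP => [j jv|/(_ i)]; last by rewrite iv.
by rewrite (label_prefix_inj jv iv).
Qed.

Lemma tree_iso_sub u v x (f : vertex d -> vertex d) : subtree u x ->
  tree_iso u v f -> tree_iso x (f x) f.
Proof.
move=> ux [fu [funf injf surf] cf].
have sub y : subtree x y -> subtree u y by apply: prefix_trans.
have mono y w : subtree u y -> prefix (f y) (f (y ++ w)).
  move=> uy; elim/last_ind: w => [|w a IH]; first by rewrite cats0 prefix_refl.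
  have [b ->] : child (f (y ++ w)) (f (y ++ rcons w a)).
    apply/cf; rewrite /subtree /=.
    - by apply: prefix_trans uy _; exact: prefix_prefix.
    - by apply: prefix_trans uy _; exact: prefix_prefix.
    - by exists a; rewrite rcons_cat.
  by apply: prefix_trans IH _; exact: prefix_rcons.
split=> //; last by move=> y z xy xz; apply: cf; exact: sub.
split.
- by move=> y /prefixP[w ->]; exact: mono.
- by move=> y z; rewrite !inE => xy xz; apply: injf; rewrite inE; exact: sub.
move=> z /prefixP[w ->]; elim/last_ind: w => [|w a [y xy e]].
  by exists x; rewrite ?cats0 //; exact: subtree_refl.
have vz : subtree v (f x ++ rcons w a).
  rewrite /subtree /=; apply: prefix_trans (prefix_prefix _ _).
  by have := funf _ ux.
have [y' uy' e'] := surf _ vz.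
have [b yb] : child y y'.
  apply/cf => //; first exact: sub.
  by rewrite e e'; exists a; rewrite rcons_cat.
exists y' => //; rewrite yb /subtree /=.
by apply: prefix_trans xy _; exact: prefix_rcons.
Qed.

Lemma lambda_iso v : tree_iso v (root d) (lambda D v).
Proof.
have [n] := ubnP (size v); elim: n v => // n IH v nv.
have [->|/label_prefix_ex[i iv]] := eqVneq v (root d).
  by rewrite lambda_root; exact: tree_iso_id.
rewrite (lambdaE iv); apply: tree_iso_comp (IH _ _).
  exact: tree_iso_sub iv (lam_iso D i).
have [w e] := prefixP iv.
move: nv; rewrite e (tree_iso_size w (lam_iso D i)) size_cat size_label.
by rewrite add0n add1n.
Qed.

Lemma section_iso v (h : autT d) : h v = v ->
  tree_iso (root d) (root d) (section D v h).
Proof.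
move=> hv; apply: tree_iso_comp (tree_iso_pinv (lambda_iso v)) _.
apply: tree_iso_comp (lambda_iso v).
by rewrite -{2}hv; exact: tree_iso_sub (subtree_root v) (aut_isoP h).
Qed.

End PathDataFacts.

Definition is_subgroup d (H : set (autT d)) : Prop := group_closed [in H].

Definition closed_subgroup d (H : set (autT d)) : Prop :=
  is_subgroup H /\ closed H.

Definition self_similar d (D : path_data d) (H : set (autT d)) : Prop :=
  closed_subgroup H /\ forall v, section_group D H v `<=` H.

Definition fractal d (D : path_data d) (H : set (autT d)) : Prop :=
  closed_subgroup H /\ forall v, section_group D H v = H.

Definition self_similar_closure d (D : path_data d) (G H : set (autT d))
    : set (autT d) :=
  \bigcap_(K in [set K | [/\ self_similar D K, H `<=` K & K `<=` G]]) K.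

Definition open_normal_subgroup d (G H : set (autT d)) : Prop :=
  [/\ is_subgroup H, H `<=` G, open (H : set (subspace G)) &
      forall h g, H h -> G g -> H (h ^ g)%g].

Definition torsion d (H : set (autT d)) : Prop :=
  forall h, H h -> exists2 n : nat, 0 < n & (h ^+ n)%g = 1%g.

Definition profinite d (H : set (autT d)) : Prop :=
  [/\ is_subgroup H, compact H, hausdorff_space (set_type H) &
      totally_disconnected H].

(* H/N is isomorphic to the finite group Q, by way of phi, whose values outside
   of H are irrelevant. *)
Definition quotient_iso d (H N : set (autT d)) (Q : finGroupType)
    (phi : autT d -> Q) : Prop :=
  [/\ {in H &, {morph phi : x y / (x * y)%g}},
      phi @` H = [set: Q] &
      forall h, H h -> (phi h = 1%g <-> N h)].

(* Profinite, with all quotients by open normal subgroups in the class C of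
   finite groups. *)
Definition pro d (C : finGroupType -> Prop) (H : set (autT d)) : Prop :=
  profinite H /\
  forall N, open_normal_subgroup H N ->
    exists (Q : finGroupType) (phi : autT d -> Q),
      quotient_iso H N phi /\ C Q.

Definition pro_p d (p : nat) : set (autT d) -> Prop :=
  pro (fun Q => (p.-group [set: Q]%G)%g).

Definition prosolvable d : set (autT d) -> Prop :=
  pro (fun Q => solvable [set: Q]%G).

Definition self_similarity_closed d (D : path_data d) (G : set (autT d))
    (F : set (autT d) -> Prop) : Prop :=
  forall H, F H -> F (self_similar_closure D G H).

Section ClosureFacts.
Variables (d : nat) (D : path_data d) (G H : set (autT d)).
Hypotheses (ssG : self_similar D G) (HG : H `<=` G).

Let K := self_similar_closure D G H.

Lemma self_similar_closure_least :
  [/\ self_similar D K, H `<=` K, K `<=` G &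
      forall L, self_similar D L -> H `<=` L -> L `<=` G -> K `<=` L].
Proof.
split.
- split; first split.
  + split; first by rewrite inE => L [[[[L1 _] _] _] _ _]; rewrite inE in L1.
    move=> x y; rewrite !inE => Kx Ky L LP.
    have [[[[_ LD] _] _] _ _] := LP.
    by have := LD x y; rewrite !inE; apply; [exact: Kx|exact: Ky].
  + by apply: closed_bigI => L [[[_ ?] _] _ _].
  + move=> v g [h [Kh hv] gh] L LP; have [[_ ss] _ _] := LP.
    by apply: (ss v); exists h => //; split=> //; exact: Kh.
- by move=> h Hh L [_ HL _]; exact: HL.
- by move=> g; apply; split.
- by move=> L ssL HL LG g; apply; split.
Qed.

End ClosureFacts.

(* Main.v *)
Require Import Defs.
From mathcomp Require Import all_boot all_fingroup all_solvable.
From mathcomp Require Import boolp classical_sets functions.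
From mathcomp Require Import topology.

(* Let M be an open normal subgroup of the fractal group G. As pi_v maps the
   stabilizer of v onto G, the section group M^v is normal in G, and it is open
   by compactness of G. Each of the three families is stable under M |-> M^v,
   the quotients of M^v by open normal subgroups being sections of finite
   quotients of M, and under products of two members. Since H has finite index
   in G, among the members of the family between H and its self-similar closure
   K there is a maximal one M; then M * M^v = M for all v, so that M is
   self-similar and equals K. *)

Set Implicit Arguments.
Unset Strict Implicit.
Unset Printing Implicit Defensive.
Local Open Scope classical_set_scope.
Local Open Scope group_scope.

Section AutT.
Variable d : nat.
Implicit Types (g h : autT d) (A H : set (autT d)).

(** * Neighbourhoods in Aut T *)

Notation ptws_vertex :=
  {ptws discrete_topology (vertex d) -> discrete_topology (vertex d)}.

Definition agree n g h := forall x, size x <= n -> g x = h x.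

Lemma eval_nbhs g x : nbhs g [set h : autT d | h x = g x].
Proof.
pose e := fun f : ptws_vertex => f x.
have ce : continuous e by move=> f; exact: proj_continuous.
have ci := @initial_continuous (autT d) _ (@aut_fun d : autT d -> ptws_vertex).
have : continuous (e \o (@aut_fun d : autT d -> ptws_vertex)).
  by move=> f; apply: continuous_comp; [exact: ci|exact: ce].
move=> /(_ g [set g x]); apply.
by rewrite nbhs_principalE.
Qed.

(** There are finitely many vertices up to a given level, so agreement with [g] there is a finite
    intersection of evaluation neighbourhoods. This countable basis reduces the topology to levels
    of the tree. *)
Lemma nbhs_autP g A : nbhs g A <-> exists n, forall h, agree n g h -> A h.
Proof.
split; last first.
  (* [n.-bseq 'I_d] is the finite type of the vertices of level at most [n]. *)
  move=> [n sA]; have := @filter_forall (autT d) (n.-bseq 'I_d)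
    (fun x : n.-bseq 'I_d => [set h : autT d | h x = g x]) (nbhs g) _.
  move=> /(_ _ (fun x => eval_nbhs g x)).
  apply: filterS => h hg; apply: sA => x xn.
  by rewrite -(hg (Bseq xn)).
rewrite nbhsE => -[U [[V oV VU] Ug] UA].
(* The sets of functions agreeing with [g] up to some level generate a filter that converges
   pointwise to [g]; hence one of them lies in [V]. *)
pose F : set_system ptws_vertex :=
  filter_from [set: nat]
    (fun n => [set f | forall x, size x <= n -> f x = g x]).
have FF : Filter F.
  apply: filter_from_filter; first by exists 0.
  move=> i j _ _; exists (maxn i j) => // f fg; split=> x xn; apply: fg.
    by rewrite leq_max xn.
  by rewrite leq_max xn orbT.
have Fg : F --> (aut_fun g : ptws_vertex).
  apply/pointwise_cvgP => x B; rewrite nbhs_principalE => /principal_filterP Bx.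
  by exists (size x) => // f /= fg; rewrite /= fg.
have [|n _ nV] := Fg V.
  by apply: open_nbhs_nbhs; split => //; rewrite -VU in Ug.
exists n => h gh; apply: UA; rewrite -VU; apply: nV => x xn.
by rewrite gh.
Qed.

Lemma aut_size g x : size (g x) = size x.
Proof. by have := tree_iso_size x (aut_isoP g). Qed.

Lemma aut_eqP g h : (forall x, g x = h x) -> g = h.
Proof. by move=> gh; apply: autP; exact/funext. Qed.

Lemma aut_invK g x : g^-1 (g x) = x.
Proof. by rewrite -[RHS]/((1 : autT d) x) -(mulVg g). Qed.

Lemma aut_invKV g x : g (g^-1 x) = x.
Proof. by rewrite -[RHS]/((1 : autT d) x) -(mulgV g). Qed.

(** * Subgroups, compactness and total disconnectedness *)

Section Subgroup.
Variables (H : set (autT d)) (sH : is_subgroup H).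

Lemma subgroup1 : H 1.
Proof. by case: sH; rewrite inE. Qed.

Lemma subgroup_div g h : H g -> H h -> H (g * h^-1).
Proof. by case: sH => _ sV Hg Hh; have := sV g h; rewrite !inE; exact. Qed.

Lemma subgroupV g : H g -> H g^-1.
Proof.
move=> Hg; rewrite -[g^-1]mul1g; apply: subgroup_div => //; exact: subgroup1.
Qed.

Lemma subgroupM g h : H g -> H h -> H (g * h).
Proof.
move=> Hg Hh; rewrite -[h]invgK; apply: subgroup_div => //; exact: subgroupV.
Qed.

End Subgroup.

Lemma subgroup_intro H :
  H 1 -> (forall g h, H g -> H h -> H (g * h^-1)) -> is_subgroup H.
Proof. by move=> H1 HD; split=> [|g h]; rewrite !inE //; exact: HD. Qed.

(** Automorphisms preserve levels, which are finite, so an ultrafilter decides the image of every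
    vertex. These images form a function [f], the limit of the ultrafilter. *)
Lemma autT_compact : compact [set: autT d].
Proof.
rewrite compact_ultra => F UF _.
have val_ex (e : autT d -> vertex d) n : (forall g, size (e g) = n) ->
    exists y, F [set g | e g = y].
  move=> sz; apply: contrapT => /forallNP noy.
  have : F [set g | forall y : n.-bseq 'I_d, e g <> y].
    apply: filter_forall => y /=.
    by case: (in_ultra_setVsetC [set g | e g = y] UF) => // /noy.
  move=> /filter_ex[g] /= gy.
  have eg : size (e g) <= n by rewrite sz.
  exact: (gy (Bseq eg)).
have /choice[f fP] x : exists y, F [set g : autT d | g x = y].
  by apply: (val_ex _ (size x)) => g; rewrite aut_size.
(* The limit [k] of the inverses is a two-sided inverse of [f], which makes [f] bijective. *)
have /choice[k kP] x : exists y, F [set g : autT d | g^-1 x = y].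
  by apply: (val_ex _ (size x)) => g; rewrite aut_size.
have fK x : k (f x) = x.
  have [g /= [<- <-]] := filter_ex (filterI (fP x) (kP (f x))).
  exact: aut_invK.
have kK x : f (k x) = x.
  have [g /= [<- <-]] := filter_ex (filterI (kP x) (fP (k x))).
  exact: aut_invKV.
have f_iso : tree_iso (Defs.root d) (Defs.root d) f.
  split.
  - by have [g /= <-] := filter_ex (fP (Defs.root d)); have [] := aut_isoP g.
  - split=> [x _|x y _ _ e|x _].
    + exact: subtree_root.
    + by rewrite -(fK x) e fK.
    + by exists (k x) => //; exact: subtree_root.
  - move=> x y rx ry.
    have [g /= [<- <-]] := filter_ex (filterI (fP x) (fP y)).
    by have [_ _] := aut_isoP g; exact.
exists (AutT f_iso); split=> // A /nbhs_autP[n sA].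
have : F [set g : autT d | forall x : n.-bseq 'I_d, g x = f x].
  by apply: filter_forall => y; exact: fP.
apply: filterS => g gf; apply: sA => x xn /=.
by rewrite (gf (Bseq xn)).
Qed.

Lemma closed_compact H : closed H -> compact H.
Proof. by move=> cH; apply: subclosed_compact cH autT_compact _. Qed.

Lemma seq_cluster_point H (h : nat -> autT d) :
  closed H -> (forall n, H (h n)) ->
  exists2 g, H g & forall m k, exists2 n, k <= n & agree m g (h n).
Proof.
move=> /closed_compact cH Hh.
have [|g [Hg gcl]] := cH (h @ \oo) _.
  by exists 0 => // n _; exact: Hh.
exists g => // m k.
have [] := gcl [set h n | n in [set n | k <= n]] [set h | agree m g h].
- by exists k => // n kn; exists n.
- by apply/nbhs_autP; exists m.
by move=> _ [[n kn <-] ?]; exists n.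
Qed.

Lemma set_type_hausdorff H : hausdorff_space (set_type H).
Proof.
move=> p q pq; apply: val_inj; apply: aut_eqP => x.
have nx (r : set_type H) : nbhs r [set s : set_type H | val s x = val r x].
  have := @initial_continuous (set_type H) (autT d) set_val.
  move=> /(_ r [set h | h x = val r x]); apply.
  exact: eval_nbhs.
by have [s [/= <- <-]] := pq _ _ (nx p) (nx q).
Qed.

Lemma open_eval x y : open [set g : autT d | g x = y].
Proof. by rewrite openE => g /= <-; exact: eval_nbhs. Qed.

Lemma closed_eval x y : closed [set g : autT d | g x = y].
Proof.
rewrite -openC (_ : ~` _ =
  \bigcup_(z in [set z | z <> y]) [set g : autT d | g x = z]).
  by apply: bigcup_open => z _; exact: open_eval.
by apply/seteqP; split=> [g gxy|g [z zy /= ->]] //=; exists (g x).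
Qed.

Lemma aut_totally_disconnected H : totally_disconnected H.
Proof.
move=> g Hg; apply/seteqP; split; last first.
  move=> _ ->; exists [set g] => //; split=> //; first by move=> _ ->.
  exact: connected1.
move=> h [C [Cg CH cC] Ch]; apply: aut_eqP => x.
(* Evaluation at [x] has clopen fibres, so a connected set through [g] stays in the fibre of [g]. *)
suff e : C `&` [set h : autT d | h x = g x] = C by move: Ch; rewrite -e => -[].
apply: cC; first by exists g.
  by exists [set h : autT d | h x = g x] => //; exact: open_eval.
by exists [set h : autT d | h x = g x] => //; exact: closed_eval.
Qed.

Lemma closed_subgroup_profinite H : closed_subgroup H -> profinite H.
Proof.
move=> [sH cH]; split=> //; first exact: closed_compact.
  exact: set_type_hausdorff.
exact: aut_totally_disconnected.
Qed.

(** * Level stabilizers and open subgroups *)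

Definition level_stab n : set (autT d) :=
  [set g | forall x, size x <= n -> g x = x].

Lemma agreeE n g h : agree n g h <-> level_stab n (g^-1 * h).
Proof.
split=> [gh x xn|gh x xn]; first by rewrite /= -gh //; exact: (aut_invK g x).
have e : g^-1 (h x) = x := gh x xn.
by rewrite -[in LHS]e aut_invKV.
Qed.

Lemma open_subgroupP G H : is_subgroup G -> is_subgroup H -> H `<=` G ->
  open (H : set (subspace G)) <-> exists n, G `&` level_stab n `<=` H.
Proof.
move=> sG sH HG; rewrite open_subspaceP; split.
  move=> [V oV VG]; have : V 1.
    by have : (H `&` G) 1 by [split; exact: subgroup1]; rewrite -VG => -[].
  move: oV; rewrite openE => /[apply] /nbhs_autP[n nV].
  exists n => g [Gg gn]; have : (V `&` G) g.
    by split=> //; apply: nV => x xn; rewrite gn.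
  by rewrite VG => -[].
(* The open set tracing [H] on [G] is the union of the balls of level [n] around the elements of
   [H]. *)
move=> [n nH]; exists [set g | exists2 h, H h & agree n h g].
  rewrite openE => g [h Hh hg]; apply/nbhs_autP; exists n => k gk.
  by exists h => // x xn; rewrite hg // gk.
apply/seteqP; split=> g [].
  move=> [h Hh /agreeE hg] Gg; split=> //.
  rewrite -[g](mulVKg h); apply: (subgroupM sH) => //; apply: nH; split=> //.
  by apply: (subgroupM sG) => //; apply: (subgroupV sG); exact: HG.
by move=> Hg Gg; split=> //; exists g.
Qed.

(** A point [g] of the closure agrees up to level [n] with some [h] in [H]; as [g] lies in the
    closed group [G], the element [g^-1 * h] falls into [H], and so does [g]. *)
Lemma open_subgroup_closed G H :
  closed_subgroup G -> is_subgroup H -> H `<=` G ->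
  open (H : set (subspace G)) -> closed_subgroup H.
Proof.
move=> [sG cG] sH HG /(open_subgroupP sG sH HG)[n nH]; split=> // g gcl.
have [|h [Hh /agreeE gh]] := gcl [set h | agree n g h].
  by apply/nbhs_autP; exists n.
have Gg : G g.
  apply: cG => B /gcl[k [Hk Bk]]; exists k; split=> //; exact: HG.
have : H (g^-1 * h).
  apply: nH; split=> //; apply: (subgroupM sG); first exact: (subgroupV sG).
  exact: HG.
move=> /(subgroupV sH) /(subgroupM sH Hh).
by rewrite invgM invgK mulVKg.
Qed.

Lemma level_stab_subgroup n : is_subgroup (level_stab n).
Proof.
apply: subgroup_intro => // g h gn hn x xn.
have e : h^-1 x = x by rewrite -[in LHS](hn x xn) aut_invK.
by rewrite -[LHS]/(g (h^-1 x)) e gn.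
Qed.

Lemma level_stabJ n g h : level_stab n g -> level_stab n (g ^ h).
Proof.
move=> gn x xn; rewrite -[LHS]/(h^-1 (g (h x))) gn ?aut_size //.
exact: aut_invK.
Qed.

(** * Products of normal subgroups *)

Definition set_mul A B : set (autT d) :=
  [set g | exists a b, [/\ A a, B b & g = a * b]].

Definition normal_in G H := forall h g, H h -> G g -> H (h ^ g).

Section Normal.
Variables (G A B : set (autT d)).
Hypotheses (sG : is_subgroup G) (sA : is_subgroup A) (sB : is_subgroup B).
Hypotheses (AG : A `<=` G) (BG : B `<=` G).
Hypotheses (nA : normal_in G A) (nB : normal_in G B).

Lemma normal_mul_swap a b : A a -> G b -> exists2 a', A a' & b * a = a' * b.
Proof.
move=> Aa Gb; exists (a ^ b^-1); first by apply: nA => //; exact: subgroupV.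
by rewrite conjgCV.
Qed.

Lemma set_mul_subgroup : is_subgroup (set_mul A B).
Proof.
apply: subgroup_intro.
  by exists 1, 1; rewrite mulg1; split=> //; exact: subgroup1.
move=> _ _ [a [b [Aa Bb ->]]] [a' [b' [Aa' Bb' ->]]].
have [|a'' Aa'' e] := normal_mul_swap (subgroupV sA Aa') (b := b * b'^-1).
  by apply: subgroup_div => //; exact: BG.
exists (a * a''), (b * b'^-1); split.
- exact: subgroupM.
- exact: subgroup_div.
- by rewrite invgM !mulgA -(mulgA a b) -(mulgA a (b * _)) e !mulgA.
Qed.

Lemma set_mul_sub : set_mul A B `<=` G.
Proof. by move=> _ [a [b [/AG Ga /BG Gb ->]]]; exact: subgroupM. Qed.

Lemma set_mul_normal : normal_in G (set_mul A B).
Proof.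
move=> _ g [a [b [Aa Bb ->]]] Gg; exists (a ^ g), (b ^ g).
by rewrite conjMg; split=> //; [exact: nA|exact: nB].
Qed.

Lemma set_mull : A `<=` set_mul A B.
Proof.
by move=> a Aa; exists a, 1; rewrite mulg1; split=> //; exact: subgroup1.
Qed.

Lemma set_mulr : B `<=` set_mul A B.
Proof.
by move=> b Bb; exists 1, b; rewrite mul1g; split=> //; exact: subgroup1.
Qed.

End Normal.

Lemma open_normalP G H : is_subgroup G -> open_normal_subgroup G H <->
  [/\ is_subgroup H, H `<=` G, exists n, G `&` level_stab n `<=` H &
      normal_in G H].
Proof.
by move=> sG; split=> -[sH HG oH nH]; split=> //; apply/open_subgroupP.
Qed.

Lemma open_normal_mul G A B : is_subgroup G -> open_normal_subgroup G A ->
  open_normal_subgroup G B -> open_normal_subgroup G (set_mul A B).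
Proof.
move=> sG /(open_normalP _ sG)[sA AG [n nA] NA].
move=> /(open_normalP _ sG)[sB BG _ NB].
apply/open_normalP => //; split.
- exact: (@set_mul_subgroup G).
- exact: set_mul_sub.
- by exists n => g /nA; exact: set_mull.
- exact: set_mul_normal.
Qed.

(** Modulo [A], the powers of [a * b] are those of [b]. Hence a power of [a * b] lies in [A], where
    it has finite order. *)
Lemma torsion_mul G A B : is_subgroup G -> is_subgroup A -> B `<=` G ->
  normal_in G A -> torsion A -> torsion B -> torsion (set_mul A B).
Proof.
move=> sG sA BG nA tA tB _ [a [b [Aa Bb ->]]].
have [n n0 bn] := tB b Bb.
have pow m : exists2 a', A a' & (a * b) ^+ m = a' * b ^+ m.
  elim: m => [|m [a' Aa' e]].
    by exists 1; rewrite ?mulg1 //; exact: subgroup1.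
  have [a'' Aa'' e'] := normal_mul_swap sG nA Aa' (BG _ Bb).
  exists (a * a''); first exact: subgroupM.
  by rewrite !expgS e !mulgA -(mulgA a b) e' !mulgA.
have [a' Aa'] := pow n; rewrite bn mulg1 => e.
have [m m0 am] := tA a' Aa'.
by exists (n * m)%N; rewrite ?muln_gt0 ?n0 // expgnA e.
Qed.

(** * Maps that are multiplicative on a subgroup only *)

Section LocalMorphism.
Variables (gT : groupType) (H : set (autT d)) (phi : autT d -> gT).
Hypotheses (sH : is_subgroup H) (phiM : {in H &, {morph phi : x y / x * y}}).

Lemma lmorphM g h : H g -> H h -> phi (g * h) = phi g * phi h.
Proof. by move=> Hg Hh; rewrite phiM ?inE. Qed.

Lemma lmorph1 : phi 1 = 1.
Proof.
have := lmorphM (subgroup1 sH) (subgroup1 sH); rewrite mulg1 => e.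
by apply: (mulgI (phi 1)); rewrite -e mulg1.
Qed.

Lemma lmorphV g : H g -> phi g^-1 = (phi g)^-1.
Proof.
move=> Hg; apply: (mulgI (phi g)).
by rewrite -lmorphM ?mulgV ?lmorph1 //; exact: subgroupV.
Qed.

Lemma lmorphX g n : H g -> phi (g ^+ n) = phi g ^+ n.
Proof.
move=> Hg; suff [] : H (g ^+ n) /\ phi (g ^+ n) = phi g ^+ n by [].
elim: n => [|n [Hn IH]].
  by rewrite !expg0 lmorph1; split=> //; exact: subgroup1.
by rewrite !expgS lmorphM // IH; split=> //; exact: subgroupM.
Qed.

Lemma lmorphJ g h : H g -> H h -> phi (g ^ h) = phi g ^ phi h.
Proof.
move=> Hg Hh; have [HV HM] := (subgroupV sH Hh, subgroupM sH Hg Hh).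
by rewrite !conjgE !lmorphM ?lmorphV.
Qed.

End LocalMorphism.

(** * The projection pi_v and the section groups *)

Section Projection.
Variables (D : path_data d) (v : vertex d).

(** This is pi_v as a total function on Aut T; the value 1 off the stabilizer of [v] is a mere
    default. *)
Definition section_aut (h : autT d) : autT d :=
  if pselect (h v = v) is left hv then AutT (section_iso D hv) else 1.

Lemma section_autS h : h v = v -> aut_fun (section_aut h) = Defs.section D v h.
Proof. by rewrite /section_aut; case: pselect. Qed.

Lemma section_groupE H :
  Defs.section_group D H v = section_aut @` stabilizer H v.
Proof.
apply/seteqP; split=> [g [h [Hh hv] gh]|_ [h [Hh hv] <-]].
  by exists h => //; apply: autP; rewrite section_autS.
by exists h => //; rewrite section_autS.
Qed.

Lemma section_autE h y : h v = v -> subtree v y ->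
  section_aut h (lambda D v y) = lambda D v (h y).
Proof.
move=> hv vy; rewrite section_autS // /Defs.section /=.
have [_ [_ inj _] _] := lambda_iso D v.
by rewrite pinvKV // inE.
Qed.

(** Identities between sections are checked at vertices [lambda D v y], where [section_autE]
    computes them; the size of [y] records the shift of levels by that of [v]. *)
Lemma lambda_preimage x :
  exists y, [/\ subtree v y, size y = size v + size x & lambda D v y = x].
Proof.
have [_ [_ _ surj] _] := lambda_iso D v.
have [y vy yx] := surj x (subtree_root x).
have [w yw] := prefixP vy; exists y; split=> //.
by rewrite -yx yw (tree_iso_size w (lambda_iso D v)) size_cat.
Qed.

Lemma stab_subtree h y : h v = v -> subtree v y -> subtree v (h y).
Proof.
move=> hv vy; have [_ [hf _ _] _] := tree_iso_sub (subtree_root v) (aut_isoP h).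
by have := hf y vy; rewrite hv.
Qed.

Lemma section_autM g h : g v = v -> h v = v ->
  section_aut (g * h) = section_aut g * section_aut h.
Proof.
move=> gv hv; apply: aut_eqP => x; have [y [vy _ <-]] := lambda_preimage x.
rewrite section_autE //=; last by rewrite -[LHS]/(g (h v)) hv gv.
by rewrite !section_autE //; exact: stab_subtree.
Qed.

Lemma section_aut_agree n g h : g v = v -> h v = v -> agree (size v + n) g h ->
  agree n (section_aut g) (section_aut h).
Proof.
move=> gv hv gh x xn; have [y [vy sy <-]] := lambda_preimage x.
by rewrite !section_autE // gh // sy leq_add2l.
Qed.

Lemma section_aut1 : section_aut 1 = 1.
Proof.
apply: aut_eqP => x; have [y [vy _ <-]] := lambda_preimage x.
by rewrite section_autE.
Qed.

Section Stabilizer.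
Variable H : set (autT d).
Hypothesis sH : is_subgroup H.

Lemma stabilizer_subgroup : is_subgroup (stabilizer H v).
Proof.
apply: subgroup_intro; first by split=> //; exact: subgroup1.
move=> g h [Hg gv] [Hh hv]; split; first exact: subgroup_div.
have e : h^-1 v = v by rewrite -[in LHS]hv aut_invK.
by rewrite -[LHS]/(g (h^-1 v)) e.
Qed.

Lemma section_aut_lmorph :
  {in stabilizer H v &, {morph section_aut : x y / x * y}}.
Proof. by move=> g h; rewrite !inE => -[_ gv] [_ hv]; exact: section_autM. Qed.

Lemma section_subgroup : is_subgroup (Defs.section_group D H v).
Proof.
have sS := stabilizer_subgroup; rewrite section_groupE; apply: subgroup_intro.
  by exists 1; [exact: subgroup1|exact: section_aut1].
move=> _ _ [g Hg <-] [h Hh <-]; exists (g * h^-1); first exact: subgroup_div.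
rewrite (lmorphM section_aut_lmorph) ?(lmorphV sS section_aut_lmorph) //.
exact: subgroupV.
Qed.

Lemma section_torsion : torsion H -> torsion (Defs.section_group D H v).
Proof.
move=> tH; rewrite section_groupE => _ [h [Hh hv] <-].
have [n n0 hn] := tH h Hh; exists n => //.
by rewrite -(lmorphX stabilizer_subgroup section_aut_lmorph) ?hn ?section_aut1.
Qed.

End Stabilizer.

(* Otherwise some k_m in G fixing the level m lie outside of M^v. If h is a
   cluster point of preimages h_m of the k_m, then pi_v h = 1, while h^-1 h_m
   lies in the open subgroup M for some m, so that k_m = pi_v (h^-1 h_m) lies
   in M^v. *)
Lemma section_open G M :
  closed G -> is_subgroup G -> Defs.section_group D G v = G ->
  (exists n, G `&` level_stab n `<=` M) ->
  exists n, G `&` level_stab n `<=` Defs.section_group D M v.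
Proof.
move=> cG sG GvG [n nM]; apply: contrapT => /forallNP no.
have /choice[h hP] m : exists h, [/\ G h, h v = v,
    level_stab m (section_aut h) &
    ~ Defs.section_group D M v (section_aut h)].
  have /existsNP[k /not_implyP[[Gk mk] nk]] := no m.
  move: Gk; rewrite -{1}GvG section_groupE => -[h [Gh hv] hk].
  by exists h; rewrite hk.
have [|g Gg gP] := @seq_cluster_point G h cG.
  by move=> m; have [] := hP m.
have gv : g v = v.
  by have [m _ gm] := gP (size v) 0; rewrite gm //; have [] := hP m.
(* Two bounds are needed: agreement up to level [size v + size x] makes the projections of [g] and
   [h m] agree at [x], and [size x <= m] makes that of [h m] fix [x]. *)
have g1 : section_aut g = 1.
  apply: aut_eqP => x; have [m xm gm] := gP (size v + size x)%N (size x).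
  by have [_ hv hm _] := hP m; rewrite (section_aut_agree gv hv gm) // hm.
have [m _ /agreeE gm] := gP n 0; have [Gh hv _] := hP m.
apply; rewrite section_groupE; exists (g^-1 * h m).
  split; first by apply: nM; split=> //; apply: subgroupM => //;
      exact: subgroupV.
  by rewrite -[LHS]/(g^-1 (h m v)) hv -[in LHS]gv aut_invK.
have sT := stabilizer_subgroup sG; have pM := @section_aut_lmorph G.
rewrite (lmorphM pM) ?(lmorphV sT pM) ?g1 ?invg1 ?mul1g //.
by apply: (subgroupV sT).
Qed.

Lemma section_open_normal G M :
  closed_subgroup G -> Defs.section_group D G v = G ->
  open_normal_subgroup G M -> open_normal_subgroup G (Defs.section_group D M v).
Proof.
move=> [sG cG] GvG /(open_normalP _ sG)[sM MG oM nM].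
apply/open_normalP => //; split; first exact: section_subgroup.
- by rewrite -GvG => g [h [Mh hv] gh]; exists h => //; split=> //; exact: MG.
- exact: section_open.
(* As G^v = G, the conjugating element also lifts to the stabilizer of [v], so the conjugation can
   be done in [G] before projecting. *)
move=> k g; rewrite -[G]GvG !section_groupE => -[h [Mh hv] <-] [f [Gf fv] <-].
have Sh : stabilizer G v h by split=> //; exact: MG.
have Sf : stabilizer G v f by [].
have sS := stabilizer_subgroup sG.
rewrite -(lmorphJ sS (@section_aut_lmorph G)) //; exists (h ^ f) => //; split.
  exact: nM.
have [] // : stabilizer G v (h ^ f).
by apply: (subgroupM sS); [exact: (subgroupV sS)|exact: (subgroupM sS)].
Qed.

End Projection.

(** * Finite images and finite quotients *)

Section Image.
Variables (gT : finGroupType) (H : set (autT d)) (phi : autT d -> gT).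

Definition fin_image : {set gT} :=
  finset (fun q => `[< exists2 h, H h & phi h = q >]).

Lemma fin_imageP q : reflect (exists2 h, H h & phi h = q) (q \in fin_image).
Proof. by rewrite inE; exact: asboolP. Qed.

Lemma mem_fin_image h : H h -> phi h \in fin_image.
Proof. by move=> Hh; apply/fin_imageP; exists h. Qed.

Lemma fin_image_group : is_subgroup H -> {in H &, {morph phi : x y / x * y}} ->
  group_set fin_image.
Proof.
move=> sH pM; apply/group_setP; split.
  by rewrite -(lmorph1 sH pM); apply: mem_fin_image; exact: subgroup1.
move=> _ _ /fin_imageP[g Hg <-] /fin_imageP[h Hh <-].
by rewrite -(lmorphM pM) //; apply: mem_fin_image; exact: subgroupM.
Qed.

End Image.

(** The images enter through equations on sets, so that [RG] can be an image group or the whole of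
    [[set: gT]]. *)
Lemma fin_image_normal (gT : finGroupType) G N (phi : autT d -> gT)
    (RG RN : {group gT}) :
  is_subgroup G -> {in G &, {morph phi : x y / x * y}} ->
  N `<=` G -> normal_in G N -> RG = fin_image G phi :> {set gT} ->
  RN = fin_image N phi :> {set gT} -> RN <| RG.
Proof.
move=> sG pM NG nN eG eN; apply/normalP; split.
  apply/fintype.subsetP => q; rewrite eN eG => /fin_imageP[h Nh <-].
  by apply: mem_fin_image; exact: NG.
suff nrm q : q \in RG -> RN :^ q \subset RN.
  move=> q Rq; apply/eqP; rewrite finset.eqEsubset nrm //=.
  by rewrite -sub_conjgV nrm ?groupV.
rewrite eG => /fin_imageP[f Gf <-] {q}.
apply/fintype.subsetP => _ /imsetP[q + ->].
rewrite eN => /fin_imageP[h Nh <-].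
have -> : phi h ^ phi f = phi (h ^ f) by rewrite -(lmorphJ sG pM) //; exact: NG.
by apply: mem_fin_image; exact: nN.
Qed.

Section LevelAction.
Variable n : nat.

Lemma level_act_size g (x : n.-bseq 'I_d) : size (g x) <= n.
Proof. by rewrite aut_size; exact: size_bseq. Qed.

Definition level_act g (x : n.-bseq 'I_d) : n.-bseq 'I_d :=
  Bseq (level_act_size g x).

Lemma level_act_inj g : injective (level_act g).
Proof.
move=> x y /(congr1 val) /= e; apply: val_inj.
by rewrite -[LHS](aut_invK g) e aut_invK.
Qed.

(* The inverse turns the left action of Aut T into a right one. *)
Definition level_perm g : {perm n.-bseq 'I_d} := perm (@level_act_inj g^-1).

Lemma level_permM : {morph level_perm : g h / g * h}.
Proof.
move=> g h; apply/permP => x; rewrite permM !permE; apply: val_inj.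
by rewrite -[LHS]/((g * h)^-1 (val x)) invgM.
Qed.

Lemma level_perm_stab g h :
  level_perm g = level_perm h -> level_stab n (g * h^-1).
Proof.
move=> e x xn.
have := congr1 (fun s : {perm n.-bseq 'I_d} => val (s (Bseq xn))) e.
rewrite !permE => e'; have {e'} e' : g^-1 x = h^-1 x := e'.
by rewrite -[LHS]/(g (h^-1 x)) -e' aut_invKV.
Qed.

End LevelAction.

(** [K] acts on the vertices up to a level [n] for which the kernel of the action lies in [N]. With
    [R] and [P] the images of [K] and [N], K/N is then R/P. *)
Lemma finite_quotient K N : is_subgroup K -> open_normal_subgroup K N ->
  exists (Q : finGroupType) (phi : autT d -> Q), quotient_iso K N phi.
Proof.
move=> sK /(open_normalP _ sK)[sN NK [n oN] nN].
have pM H : {in H &, {morph @level_perm n : x y / x * y}}.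
  by move=> x y _ _; exact: level_permM.
pose R := group (fin_image_group sK (pM _)).
pose P := group (fin_image_group sN (pM _)).
have PR : P <| R by exact: (fin_image_normal sK (pM _) NK nN).
have nP g : K g -> level_perm n g \in 'N(P).
  move=> Kg; apply: (fintype.subsetP (normal_norm PR)); exact: mem_fin_image.
have inQ g : K g -> coset P (level_perm n g) \in R / P.
  by move=> Kg; apply: mem_quotient; exact: mem_fin_image.
(* [subg] turns the subgroup R/P of a coset type into a finite group type of its own. *)
pose phi g := subg (R / P)%G (coset P (level_perm n g)).
exists (subg_of (R / P)%G), phi; split.
- move=> g h; rewrite !inE => Kg Kh; rewrite /phi level_permM.
  by rewrite (morphM (coset_morphism P)) ?nP // subgM // inQ.
- apply/seteqP; split=> // q _.
  have /morphimP[_ _ /fin_imageP[g Kg <-] e] := subgP q.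
  by exists g => //; rewrite /phi -[RHS]sgvalK e.
move=> h Kh; split=> [h1|Nh].
  have : coset P (level_perm n h) = 1.
    by rewrite -(subgK _ (inQ _ Kh)) -/(phi h) h1.
  (* Some [k] in [N] permutes the levels up to [n] as [h] does; thus [k * h^-1] acts trivially and
     lies in [N]. *)
  move=> /(coset_idr (nP _ Kh)) /fin_imageP[k Nk /level_perm_stab kh].
  have : N (k * h^-1).
    by apply: oN; split=> //; apply: subgroup_div => //; exact: NK.
  move=> /(subgroupV sN) /(subgroupM sN) /(_ Nk).
  by rewrite invgM invgK mulgVK.
apply: (@val_inj _ _ (subg_of (R / P)%G)).
rewrite /phi subgK ?inQ // coset_id //; exact: mem_fin_image.
Qed.

Lemma quotient_iso_eq H N (Q : finGroupType) (phi : autT d -> Q) g h :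
  is_subgroup H -> quotient_iso H N phi -> H g -> H h -> phi g = phi h ->
  N (g * h^-1).
Proof.
move=> sH [pM _ kP] Hg Hh e; apply/kP; first exact: subgroup_div.
rewrite (lmorphM pM) ?(lmorphV sH pM) ?e ?mulgV //; exact: subgroupV.
Qed.

(** * The maximality argument, and the torsion family *)

Lemma closure_in_family (D : path_data d) G (F : set (autT d) -> Prop) :
  fractal D G -> (forall M, F M -> open_normal_subgroup G M) ->
  (forall A B, F A -> F B -> F (set_mul A B)) ->
  (forall M v, F M -> F (Defs.section_group D M v)) ->
  self_similarity_closed D G F.
Proof.
move=> [cG fG] Fo Fm Fs H FH; have [sG _] := cG.
have ssG : self_similar D G by split=> // v; rewrite fG.
have [sH HG _ _] := Fo _ FH.
have [ssK HK KG Kmin] := self_similar_closure_least ssG HG.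
set K := self_similar_closure D G H in ssK HK KG Kmin *.
have [[sK cK] Kv] := ssK.
have [_ _ [n nH] _] := (open_normalP _ sG).1 (Fo _ FH).
pose im M := fin_image M (@level_perm n).
(* Members between [H] and [K] are measured by the order of their image in the permutations of the
   levels up to [n]. It is bounded, and it detects strict inclusions because [H] contains the kernel
   of the action of [G]. *)
pose P k := `[< exists M, [/\ F M, H `<=` M, M `<=` K & #|im M| = k] >].
have exP : exists k, P k by exists #|im H|; apply/asboolP; exists H; split.
have ubP k : P k -> k <= #|{perm n.-bseq 'I_d}|.
  by move=> /asboolP[M [_ _ _ <-]]; exact: max_card.
have [_ /asboolP[M [FM HM MK <-]] maxM] := ex_maxnP exP ubP.
suff MvM v : Defs.section_group D M v `<=` M.
  have [sM MG oM _] := Fo _ FM.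
  have ssM : self_similar D M by split=> //;
    exact: open_subgroup_closed cG sM MG oM.
  suff -> : K = M by [].
  by apply/seteqP; split=> //; exact: Kmin.
have [sM MG _ nM] := Fo _ FM.
have [sV VG _ _] := Fo _ (Fs _ v FM).
set MV := Defs.section_group D M v in sV VG *.
have MMV : M `<=` set_mul M MV by exact: set_mull.
have eim : im M = im (set_mul M MV).
  apply/eqP; rewrite eqEcard; apply/andP; split.
    apply/fintype.subsetP => q /fin_imageP[h Mh <-].
    by apply: mem_fin_image; exact: MMV.
  apply: maxM; apply/asboolP; exists (set_mul M MV); split=> //.
  - by apply: Fm => //; exact: Fs.
  - by move=> h /HM /MMV.
  (* M^v lies in K^v, hence in the self-similar group [K]. *)
  - apply: set_mul_sub => // g [h [Mh hv] gh]; apply: (Kv v); exists h => //.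
    by split=> //; exact: MK.
(* Having equal images, [g] and some [h] in [M] differ by an element of [G] fixing the levels up to
   [n], that is, by an element of [H], hence of [M]. *)
move=> g MVg; have : level_perm n g \in im (set_mul M MV).
  by apply: mem_fin_image; exact: set_mulr.
rewrite -eim => /fin_imageP[h Mh /level_perm_stab hg].
have : M (h * g^-1).
  by apply: HM; apply: nH; split=> //; apply: subgroup_div => //;
    [exact: MG|exact: VG].
move=> /(subgroupV sM) /(subgroupM sM) /(_ Mh).
by rewrite invgM invgK mulgVK.
Qed.

Lemma torsion_closed (D : path_data d) G : fractal D G ->
  self_similarity_closed D G (fun H => open_normal_subgroup G H /\ torsion H).
Proof.
move=> fG; have [cG GvG] := fG; have [sG _] := cG.
apply: closure_in_family => // [M []|A B [oA tA] [oB tB]|M v [oM tM]] //; split.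
- exact: open_normal_mul.
- by have [[sA _ _ nA] [_ BG _ _]] := (oA, oB); exact: (torsion_mul sG).
- exact: section_open_normal cG (GvG v) oM.
- by have [sM _ _ _] := oM; exact: section_torsion.
Qed.

(** * Pro-C subgroups for a class C of finite groups *)

Section ProC.
(** A predicate on sets, like [pgroup] and [solvable], lets the closure properties of the class be
    stated for subgroups of an ambient group. *)
Variable C : forall gT : finGroupType, {set gT} -> bool.
Hypothesis CS : forall (gT : finGroupType) (A B : {group gT}),
  B \subset A -> C A -> C B.
Hypothesis Cmorphim : forall (aT rT : finGroupType) (D A : {group aT})
  (f : {morphism D >-> rT}), C A -> C (f @* A).
Hypothesis Cmul : forall (gT : finGroupType) (A B : {group gT}),
  A <| [set: gT]%G -> B <| [set: gT]%G ->
  A * B = [set: gT]%G :> {set gT} -> C A -> C B -> C [set: gT]%G.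

(** Since [psi] kills the intersection of [S] and [L], it factors on [S] through [phi]. So [B] is a
    morphic image of the subgroup phi(S) of [Q]: a section in the sense of subquotients. *)
Lemma section_of_quotient M L S (Q R : finGroupType) (phi : autT d -> Q)
    (psi : autT d -> R) (B : {group R}) :
  is_subgroup M -> is_subgroup S -> S `<=` M -> quotient_iso M L phi ->
  {in S &, {morph psi : x y / x * y}} -> (forall s, S s -> L s -> psi s = 1) ->
  B = fin_image S psi :> {set R} -> C [set: Q]%G -> C B.
Proof.
move=> sM sS SM qM psiM psiL eB CQ; have [phiM _ _] := qM.
have phiSM : {in S &, {morph phi : x y / x * y}}.
  by move=> x y; rewrite !inE => /SM Mx /SM My; rewrite phiM ?inE.
have psi_eq s t : S s -> S t -> phi s = phi t -> psi s = psi t.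
  move=> Ss St /(quotient_iso_eq sM qM (SM _ Ss) (SM _ St)) Lst.
  have /(psiL _)/(_ Lst) : S (s * t^-1) by exact: subgroup_div.
  rewrite (lmorphM psiM) ?(lmorphV sS psiM) //; last exact: subgroupV.
  exact: divg1_eq.
pose A := group (fin_image_group sS phiSM).
(* [sel] picks preimages in [S] under [phi], with 1 as default outside [A]; by [psi_eq] the choice
   does not affect [psi \o sel] on [A]. *)
have /choice[sel selP] q : exists s, q \in A -> S s /\ phi s = q.
  case: (boolP (q \in A)) => [/fin_imageP[s Ss e]|_]; last by exists 1.
  by exists s.
have fM : {in A &, {morph psi \o sel : x y / x * y}}.
  move=> x y Ax Ay /=; have [[Sx ex] [Sy ey]] := (selP _ Ax, selP _ Ay).
  have [Sxy exy] := selP _ (groupM Ax Ay).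
  rewrite -(lmorphM psiM) //; apply: psi_eq => //; first exact: subgroupM.
  by rewrite (lmorphM phiSM) // ex ey.
have -> : B = (Morphism fM @* A)%G.
  apply: val_inj; rewrite /= eB; apply/setP => r.
  apply/fin_imageP/morphimP => [[s Ss <-]|[q _ Aq ->]].
    have As : phi s \in A by exact: mem_fin_image.
    exists (phi s) => //=; have [Ss' e] := selP _ As; exact: psi_eq.
  by exists (sel q) => //; have [] := selP _ Aq.
apply: Cmorphim; apply: CS CQ; exact: finset.subsetT.
Qed.

Notation pro_C := (pro (fun Q : finGroupType => C [set: Q]%G)).

Lemma open_normal_sub K A N : is_subgroup K -> is_subgroup A -> A `<=` K ->
  open_normal_subgroup K N -> open_normal_subgroup A (N `&` A).
Proof.
move=> sK sA AK /(open_normalP _ sK)[sN NK [n oN] nN]; apply/open_normalP => //.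
split.
- apply: subgroup_intro; first by split; exact: subgroup1.
  by move=> g h [Ng Ag] [Nh Ah]; split; exact: subgroup_div.
- by move=> g [].
- by exists n => g [Ag gn]; split=> //; apply: oN; split=> //; exact: AK.
- move=> h g [Nh Ah] Ag; split; first by apply: nN => //; exact: AK.
  by apply: (subgroupM sA); [exact: (subgroupV sA)|exact: (subgroupM sA)].
Qed.

Lemma open_normal_profinite G H :
  closed_subgroup G -> open_normal_subgroup G H ->
  profinite H.
Proof.
move=> cG [sH HG oH _]; apply: closed_subgroup_profinite.
exact: open_subgroup_closed cG _ HG oH.
Qed.

(** A finite quotient of the product of [A] and [B] is the product of the images of [A] and [B].
    Both are normal, and they are in the class as images of finite quotients of [A] and of [B]. *)
Lemma pro_mul G A B : closed_subgroup G -> open_normal_subgroup G A ->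
  open_normal_subgroup G B -> pro_C A -> pro_C B -> pro_C (set_mul A B).
Proof.
move=> cG oA oB [_ pA] [_ pB]; have [sG _] := cG.
have oK := open_normal_mul sG oA oB.
split=> [|N oN]; first exact: open_normal_profinite oK.
have [[sA AG _ nA] [sB BG _ nB] [sK KG _ nK]] := And3 oA oB oK.
have [Q [phi qK]] := finite_quotient sK oN; exists Q, phi; split=> //.
have [phiM imK kerK] := qK.
have img X : is_subgroup X -> X `<=` set_mul A B -> normal_in G X ->
    (forall N, open_normal_subgroup X N ->
      exists (Q : finGroupType) (phi : autT d -> Q),
        quotient_iso X N phi /\ C [set: Q]%G) ->
    exists RX : {group Q},
      [/\ RX = fin_image X phi :> {set Q}, RX <| [set: Q]%G & C RX].
  move=> sX XK nX pX.
  have phiXM : {in X &, {morph phi : x y / x * y}}.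
    by move=> x y; rewrite !inE => /XK Kx /XK Ky; rewrite phiM ?inE.
  exists (group (fin_image_group sX phiXM)); split=> //.
    apply: (fin_image_normal (RG := [set: Q]%G) sK phiM XK) => //.
      by move=> h g Xh /KG; exact: nX.
    apply/setP => q; rewrite finset.in_setT; apply/esym/fin_imageP.
    by have : [set: Q]%classic q by []; rewrite -imK => -[h Kh <-]; exists h.
  have [QX [phiX [qX CX]]] := pX _ (open_normal_sub sK sX XK oN).
  apply: (section_of_quotient sX sX _ qX phiXM) CX => // s Xs [Ns _].
  by apply/kerK => //; exact: XK.
have [RA [eA nRA CA]] := img A sA (set_mull sB) nA pA.
have [RB [eB nRB CB]] := img B sB (set_mulr sA) nB pB.
apply: (Cmul nRA nRB _ CA CB); apply/setP => q; rewrite finset.in_setT.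
have : [set: Q]%classic q by []; rewrite -imK => -[_ [a [b [Aa Bb ->]]] <-].
rewrite (lmorphM phiM); [|exact: set_mull|exact: set_mulr].
by apply: mem_mulg; rewrite ?eA ?eB; exact: mem_fin_image.
Qed.

(** The quotient of M^v by [N] is a subquotient of a finite quotient M/L, by way of the stabilizer
    of [v] in [M]. *)
Lemma pro_section (D : path_data d) v G M : closed_subgroup G ->
  Defs.section_group D G v = G -> open_normal_subgroup G M -> pro_C M ->
  pro_C (Defs.section_group D M v).
Proof.
move=> cG GvG oM [_ pM]; have [sG _] := cG.
have oV := section_open_normal cG GvG oM.
split=> [|N oN]; first exact: open_normal_profinite oV.
have [[sM MG _ nM] [sV VG _ _]] := (oM, oV).
have [Q [phi qV]] := finite_quotient sV oN; exists Q, phi; split=> //.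
have [phiM imV kerV] := qV.
have [_ _ [n nN] _] := (open_normalP _ sV).1 oN.
(* As pi_v lowers levels by [size v], it maps the elements of [L] (which fix [v]) into M^v and the
   stabilizer of level [n], hence into [N]. *)
pose L := M `&` level_stab (size v + n).
have oL : open_normal_subgroup M L.
  apply/open_normalP => //; split.
  - apply: subgroup_intro; first by split=> //; exact: subgroup1.
    move=> g h [Mg gn] [Mh hn]; split; first exact: subgroup_div.
    exact: (subgroup_div (level_stab_subgroup _)).
  - by move=> g [].
  - by exists (size v + n)%N.
  - move=> h g [Mh hn] Mg; split; last exact: level_stabJ.
    by apply: nM => //; exact: MG.
have [QM [phiQ [qM CM]]] := pM _ oL.
have sS := stabilizer_subgroup v sM.
have VE := section_groupE D v M.
have inV s : stabilizer M v s -> Defs.section_group D M v (section_aut D v s).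
  by move=> Ss; rewrite VE; exists s.
apply: (section_of_quotient (psi := phi \o section_aut D v)
  (B := [set: Q]%G) sM sS _ qM) CM.
- by move=> s [].
- move=> x y; rewrite !inE => Sx Sy /=.
  have [[_ xv] [_ yv]] := (Sx, Sy).
  by rewrite section_autM // (lmorphM phiM) //; exact: inV.
- move=> s Ss [Ms sn] /=; apply/kerV; first exact: inV.
  apply: nN; split; first exact: inV.
  have [_ sv] := Ss => x xn.
  by rewrite (@section_aut_agree D v n s 1) ?section_aut1.
apply/setP => q; rewrite finset.in_setT; apply/esym/fin_imageP.
have : [set: Q]%classic q by []; rewrite -imV => -[g].
by rewrite VE => -[s Ss <-] <-; exists s.
Qed.

Lemma pro_closed (D : path_data d) G : fractal D G ->
  self_similarity_closed D G (fun H => open_normal_subgroup G H /\ pro_C H).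
Proof.
move=> fG; have [cG GvG] := fG; have [sG _] := cG.
apply: closure_in_family => // [M []|A B [oA pA] [oB pB]|M v [oM pM]] //; split.
- exact: open_normal_mul.
- exact: pro_mul cG oA oB pA pB.
- exact: section_open_normal cG (GvG v) oM.
- exact: pro_section cG (GvG v) oM pM.
Qed.

End ProC.

End AutT.

(** * The three families *)

Theorem corollary29 (d : nat) (hd : 0 < d) (D : path_data d)
    (G : set (autT d)) (hG : fractal D G) (p : nat) (hp : prime p) :
  [/\ self_similarity_closed D G
        (fun H => open_normal_subgroup G H /\ torsion H),
      self_similarity_closed D G
        (fun H => open_normal_subgroup G H /\ pro_p p H) &
      self_similarity_closed D G
        (fun H => open_normal_subgroup G H /\ prosolvable H)].
Proof.
split; first exact: torsion_closed.
- apply: (pro_closed (C := fun gT => pgroup p)) => //.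
  + by move=> gT A B BA; exact: pgroupS.
  + by move=> aT rT E A f; exact: morphim_pgroup.
  + by move=> gT A B _ _ <- pA pB; rewrite pgroupM pA.
- apply: (pro_closed (C := @solvable)) => //.
  + by move=> gT A B BA; exact: solvableS.
  + by move=> aT rT E A f; exact: morphim_sol.
  + move=> gT A B nA nB AB sA sB; rewrite -[solvable _]/(solvable [set: gT]%G).
    (* The quotient of AB by [A] is the image of [B], so the group is an extension of a solvable
       group by a solvable one. *)
    rewrite (series_sol nA) sA -AB quotientMidl; exact: quotient_sol.
Qed.
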